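(* Let $(X,Y,\langle\cdot,\cdot\rangle)$ be an asymmetric dual pair, with $X$ carrying the topology $\sigma(X,Y)$. If $(X,\sigma_s(X,Y))$ is Lindelöf, then the $\sigma_s(X,Y)$-closure of every countably compact subset of $X$ is compact.
   Context: All vector spaces and cones are over the reals; a cone is a commutative monoid $(Y,+,0)$ with a scalar multiplication by nonnegative reals satisfying the usual vector space axioms. An asymmetric dual pair $(X,Y,\langle\cdot,\cdot\rangle)$ consists of a vector space $X$, a cone $Y$ and a map $\langle\cdot,\cdot\rangle:X\times Y\to\mathbb R$ that is bilinear (with respect to nonnegative scalars in the second variable) and nondegenerate: $\langle x,\cdot\rangle=0$ implies $x=0$, and $\langle\cdot,y\rangle=\langle\cdot,z\rangle$ implies $y=z$. $\sigma(X,Y)$ is the topology on $X$ with basis the sets $\{x'\in X:\langle x'-x,y\rangle<\epsilon\ \forall y\in F\}$, with $x\in X$, $\epsilon>0$, $F\subseteq Y$ finite. $\overline\sigma(X,Y)$ is the conjugate topology, with basis the sets $\{x'\in X:\langle x-x',y\rangle<\epsilon\ \forall y\in F\}$. $\sigma_s(X,Y)$ is the smallest topology containing both. Topological spaces are not assumed Hausdorff. A set is compact (resp. countably compact) if every open cover (resp. countable open cover) has a finite subcover; a space is Lindelöf if every open cover has a countable subcover. Compactness and countable compactness refer to $\sigma(X,Y)$. *)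

(* Defs.v *)
From HB Require Import structures.
From mathcomp Require Import all_boot all_order all_algebra.
From mathcomp Require Import interval_inference lra.
From mathcomp Require Import all_classical all_reals topology.
Set Implicit Arguments.
Unset Strict Implicit.
Unset Printing Implicit Defensive.
Import Order.TTheory GRing.Theory Num.Theory.
Local Open Scope classical_set_scope.
Local Open Scope ring_scope.

(** The semiring of nonnegative reals. With it, [lSemiModType {nonneg R}] is
    the type of cones: commutative monoids with a scalar multiplication by
    nonnegative reals satisfying the vector space axioms (including
    [0 *: y = 0], which does not follow from the others without opposites). *)
Section nonneg_semiring.
Variable R : realType.
Implicit Types a b c : {nonneg R}.

Definition nneg_add a b : {nonneg R} := (a%:num + b%:num)%:nng.
Definition nneg_mul a b : {nonneg R} := (a%:num * b%:num)%:nng.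

Lemma nneg_addA : associative nneg_add.
Proof. by move=> a b c; apply: val_inj; rewrite /= addrA. Qed.
Lemma nneg_addC : commutative nneg_add.
Proof. by move=> a b; apply: val_inj; rewrite /= addrC. Qed.
Lemma nneg_add0 : left_id (0%:nng : {nonneg R}) nneg_add.
Proof. by move=> a; apply: val_inj; rewrite /= add0r. Qed.

HB.instance Definition _ := [Choice of {nonneg R} by <:].
HB.instance Definition _ :=
  GRing.isNmodule.Build {nonneg R} nneg_addA nneg_addC nneg_add0.

Lemma nneg_mulA : associative nneg_mul.
Proof. by move=> a b c; apply: val_inj; rewrite /= mulrA. Qed.
Lemma nneg_mulC : commutative nneg_mul.
Proof. by move=> a b; apply: val_inj; rewrite /= mulrC. Qed.
Lemma nneg_mul1 : left_id (1%:nng : {nonneg R}) nneg_mul.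
Proof. by move=> a; apply: val_inj; rewrite /= mul1r. Qed.
Lemma nneg_mulDl : left_distributive nneg_mul nneg_add.
Proof. by move=> a b c; apply: val_inj; rewrite /= mulrDl. Qed.
Lemma nneg_mul0 : left_zero (0%:nng : {nonneg R}) nneg_mul.
Proof. by move=> a; apply: val_inj; rewrite /= mul0r. Qed.
Lemma nneg_1neq0 : (1%:nng : {nonneg R}) != 0%:nng.
Proof. by rewrite -val_eqE /= oner_neq0. Qed.

HB.instance Definition _ :=
  GRing.Nmodule_isComNzSemiRing.Build {nonneg R}
    nneg_mulA nneg_mulC nneg_mul1 nneg_mulDl nneg_mul0 nneg_1neq0.

End nonneg_semiring.

Record asym_dual_pair (R : realType) (X : lmodType R)
    (Y : lSemiModType {nonneg R}) := AsymDualPair {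
  pairing :> X -> Y -> R ;
  pairing_linearl : forall y, scalar (pairing^~ y) ;
  pairingDr : forall x y z, pairing x (y + z) = pairing x y + pairing x z ;
  pairingZr : forall x (a : {nonneg R}) y,
    pairing x (a *: y) = a%:num * pairing x y ;
  pairing_nondegl : forall x, (forall y, pairing x y = 0) -> x = 0 ;
  pairing_nondegr : forall y z, (forall x, pairing x y = pairing x z) -> y = z
}.

(** The topologies are carried by aliases of [X], so that the three of them
    can be used on the same underlying type. The otherwise unused argument [p]
    lets the topology be inferred from the alias. *)
Definition sigma (R : realType) (X : lmodType R) (Y : lSemiModType {nonneg R})
  (p : asym_dual_pair X Y) : Type := X.
Definition sigma_conj (R : realType) (X : lmodType R)
  (Y : lSemiModType {nonneg R}) (p : asym_dual_pair X Y) : Type := X.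

Section asym_topologies.
Variables (R : realType) (X : lmodType R) (Y : lSemiModType {nonneg R}).
Variable p : asym_dual_pair X Y.

Definition sigma_base : set (set X) :=
  [set U | exists (x : X) (e : R) (F : set Y), [/\ 0 < e, finite_set F &
    U = [set x' | forall y, F y -> p (x' - x) y < e]]].
Definition sigma_conj_base : set (set X) :=
  [set U | exists (x : X) (e : R) (F : set Y), [/\ 0 < e, finite_set F &
    U = [set x' | forall y, F y -> p (x - x') y < e]]].

Lemma pairingBl x x' y : p (x - x') y = p x y - p x' y.
Proof.
by rewrite addrC -scaleN1r (pairing_linearl p y) mulN1r addrC.
Qed.

Lemma finite_slack (F : set Y) (g : Y -> R) : finite_set F ->
  (forall y, F y -> 0 < g y) ->
  exists2 e : R, 0 < e & forall y, F y -> e <= g y.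
Proof.
move=> /finite_seqP[s ->] /=.
elim: s => [|y s IH] g0; first by exists 1.
have [e e0 es] : exists2 e : R, 0 < e & forall y, y \in s -> e <= g y.
  by apply: IH => z zs; apply: g0; rewrite inE zs orbT.
exists (Num.min (g y) e); first by rewrite lt_min e0 g0 ?mem_head.
move=> z; rewrite inE => /orP[/eqP->|/es ez]; first by rewrite ge_min lexx.
by rewrite ge_min ez orbT.
Qed.

Lemma sigma_base_cover : \bigcup_(U in sigma_base) id U = setT.
Proof.
apply/seteqP; split => // x _; exists setT => //.
by exists x, 1, set0; split => //; apply/seteqP; split => // z _ y.
Qed.

Lemma sigma_conj_base_cover : \bigcup_(U in sigma_conj_base) id U = setT.
Proof.
apply/seteqP; split => // x _; exists setT => //.
by exists x, 1, set0; split => //; apply/seteqP; split => // z _ y.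
Qed.

Lemma sigma_base_join (U V : set X) t : sigma_base U -> sigma_base V -> id U t -> id V t ->
  exists W, [/\ sigma_base W, id W t & id W `<=` id U `&` id V].
Proof.
move=> [x [e [F [e0 fF ->]]]] [x' [e' [F' [e0' fF' ->]]]] /= ti tj.
have [d d0 dF] : exists2 d : R, 0 < d & forall y, F y -> d <= e - p (t - x) y.
  by apply: finite_slack => // y Fy; rewrite subr_gt0 ti.
have [d' d0' dF'] :
    exists2 d : R, 0 < d & forall y, F' y -> d <= e' - p (t - x') y.
  by apply: finite_slack => // y Fy; rewrite subr_gt0 tj.
exists [set z | forall y, (F `|` F') y -> p (z - t) y < Num.min d d'].
split => /=.
- exists t, (Num.min d d'), (F `|` F').
  by split; rewrite ?lt_min ?d0 // finite_setU.
- by move=> y _ /=; rewrite pairingBl subrr lt_min d0.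
- move=> z /= zk; split => y Fy /=.
    have := zk y (or_introl Fy); rewrite lt_min => /andP[+ _].
    by move=> /lt_le_trans /(_ (dF _ Fy)); rewrite !pairingBl; lra.
  have := zk y (or_intror Fy); rewrite lt_min => /andP[_].
  by move=> /lt_le_trans /(_ (dF' _ Fy)); rewrite !pairingBl; lra.
Qed.

Lemma sigma_conj_base_join (U V : set X) t : sigma_conj_base U -> sigma_conj_base V -> id U t -> id V t ->
  exists W, [/\ sigma_conj_base W, id W t & id W `<=` id U `&` id V].
Proof.
move=> [x [e [F [e0 fF ->]]]] [x' [e' [F' [e0' fF' ->]]]] /= ti tj.
have [d d0 dF] : exists2 d : R, 0 < d & forall y, F y -> d <= e - p (x - t) y.
  by apply: finite_slack => // y Fy; rewrite subr_gt0 ti.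
have [d' d0' dF'] :
    exists2 d : R, 0 < d & forall y, F' y -> d <= e' - p (x' - t) y.
  by apply: finite_slack => // y Fy; rewrite subr_gt0 tj.
exists [set z | forall y, (F `|` F') y -> p (t - z) y < Num.min d d'].
split => /=.
- exists t, (Num.min d d'), (F `|` F').
  by split; rewrite ?lt_min ?d0 // finite_setU.
- by move=> y _ /=; rewrite pairingBl subrr lt_min d0.
- move=> z /= zk; split => y Fy /=.
    have := zk y (or_introl Fy); rewrite lt_min => /andP[+ _].
    by move=> /lt_le_trans /(_ (dF _ Fy)); rewrite !pairingBl; lra.
  have := zk y (or_intror Fy); rewrite lt_min => /andP[_].
  by move=> /lt_le_trans /(_ (dF' _ Fy)); rewrite !pairingBl; lra.
Qed.

HB.instance Definition _ := Choice.on (sigma p).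
HB.instance Definition _ :=
  isBaseTopological.Build (sigma p) sigma_base_cover sigma_base_join.

HB.instance Definition _ := Choice.on (sigma_conj p).
HB.instance Definition _ :=
  isBaseTopological.Build (sigma_conj p) sigma_conj_base_cover
    sigma_conj_base_join.

Definition sigma_pair (b : bool) : Topological X :=
  if b then Topological.class (sigma p) else Topological.class (sigma_conj p).

Definition sigma_s : Type := sup_topology sigma_pair.
HB.instance Definition _ := Topological.on sigma_s.

End asym_topologies.

Definition countable_cover_compact (T : topologicalType) (A : set T) :=
  forall (I : choiceType) (D : set I) (f : I -> set T), countable D ->
  (forall i, D i -> open (f i)) -> A `<=` cover D f ->
  finite_subset_cover D f A.

Definition lindelof (T : topologicalType) :=
  forall (I : choiceType) (D : set I) (f : I -> set T),
  (forall i, D i -> open (f i)) -> [set: T] `<=` cover D f ->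
  exists D' : set I,
    [/\ countable D', D' `<=` D & [set: T] `<=` cover D' f].

(* Main.v *)
Require Import Defs.
From HB Require Import structures.
From mathcomp Require Import all_boot all_order all_algebra.
From mathcomp Require Import interval_inference.
From mathcomp Require Import all_classical all_reals topology.
From mathcomp Require Import finmap lra.
Local Open Scope classical_set_scope.
Local Open Scope ring_scope.
Import Order.TTheory GRing.Theory Num.Theory.

(** Cover the [sigma_s p]-closure [B] of [A] by [sigma p]-open sets. Around each
    point of [B], shrink the cover to an open [V] that lies in a
    [sigma_s p]-closed subset [C] of one of its members. The Lindelof property
    leaves countably many of the [V], countable compactness of [A] leaves
    finitely many that cover [A], and the union of the finitely many
    corresponding [C] is a [sigma_s p]-closed set containing [A], hence [B]. So
    finitely many members of the cover suffice. This argument is purely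
    topological ([countably_compact_closure_compact]).

    The shrinking is possible because [sigma p] and its conjugate are regular
    with respect to each other: a neighborhood of [s] given by the inequalities
    [p (z - s) y < d] contains the one given by [p (z - s) y < d / 2], and
    between the two lies the set given by [p (z - s) y <= d / 2], which is
    closed for the conjugate topology and therefore for the finer [sigma_s p]
    ([closed_sigma_conj_le], [sigma_regular_in_sigma_s]). *)

(** The fine space [S] and the coarse space [T] are two types related by a
    continuous map, so that the statement makes sense without putting two
    topologies on one type; the intended case is the identity map. *)
Lemma countably_compact_closure_compact (S T : topologicalType) (f : S -> T)
    (A : set S) :
  continuous f ->
  (forall s U, open U -> U (f s) -> exists V C,
     [/\ open V, V (f s), closed C, f @^-1` V `<=` C & C `<=` f @^-1` U]) ->
  lindelof S -> countable_cover_compact (f @` A) ->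
  cover_compact (f @` closure A).
Proof.
move=> fcont freg SL cA J D F Fo Fcov.
set B := closure A.
(* The index of the chosen member is optional so that a default exists for
   points outside [B] even when [J] is empty. *)
have shrink (s : S) : exists z : set T * set S * option J, B s ->
    [/\ open z.1.1, z.1.1 (f s), closed z.1.2, f @^-1` z.1.1 `<=` z.1.2 &
     exists2 i, z.2 = Some i & D i /\ z.1.2 `<=` f @^-1` F i].
  have [Bs|nBs] := pselect (B s); last by exists (set0, set0, None).
  have [i Di Fi] := Fcov _ (imageP f Bs).
  have [V [C [Vo Vs Cc VC CF]]] := freg s _ (Fo i Di) Fi.
  by exists (V, C, Some i) => _; split=> //; exists i.
have [z zP] := choice shrink.
(* Points outside the closed set [B] are covered by its complement. *)
pose G s := if `[< B s >] then f @^-1` (z s).1.1 else ~` B.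
have [||E [Ec _ Ecov]] := SL S setT G.
- move=> s _; rewrite /G; case: asboolP => [/zP[Vo _ _ _ _]|_].
    by move/continuousP: fcont; apply.
  exact/closed_openC/closed_closure.
- move=> s _; exists s => //; rewrite /G; case: asboolP => [/zP[]//|//].
have [||| E' E'E E'cov] := cA S (E `&` B) (fun s => (z s).1.1).
- exact: sub_countable (subset_card_le (@subIsetl _ E B)) Ec.
- by move=> s [_ /zP[]].
- move=> _ [a Aa <-]; have [s Es] := Ecov a I.
  rewrite /G; case: asboolP => [Bs Va|_ []]; last exact: subset_closure.
  by exists s.
have E'B s : s \in E' -> B s by move=> /E'E /set_mem[].
exists [fset i in pmap (fun s => (z s).2) E']%fset.
  move=> i; rewrite !inE /= mem_pmap => /mapP[s sE' zi].
  by have /zP[_ _ _ _ [j]] := E'B _ sE'; rewrite -zi => -[->] [Dj _]; apply: mem_set.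
have BC : B `<=` \bigcup_(s in [set` E']) (z s).1.2.
  rewrite /B closureE; apply: smallest_sub.
    by apply: closed_bigcup => // s /E'B/zP[].
  move=> a Aa; have [s sE' Va] := E'cov _ (imageP f Aa).
  by exists s => //; have /zP[_ _ _ + _] := E'B _ sE'; apply.
move=> _ [b Bb <-]; have [s sE' Cb] := BC b Bb.
have /zP[_ _ _ _ [i zi [_ CF]]] := E'B _ sE'.
exists i; last exact: CF.
by rewrite /= !inE /= mem_pmap; apply/mapP; exists s.
Qed.

Lemma open_sup_topology (T : choiceType) (I : Type) (Tc : I -> Topological T)
    (i : I) (U : set T) :
  @open (Topological.Pack (Tc i)) U -> @open (sup_topology Tc) U.
Proof.
rewrite !openE => oU x /oU.
by have /cvg_sup := @cvg_id _ (nbhs (x : sup_topology Tc)); apply.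
Qed.

Section sigma_regularity.
Variables (R : realType) (X : lmodType R) (Y : lSemiModType {nonneg R}).
Variable p : asym_dual_pair X Y.

Lemma open_sigma_base (U : set X) : sigma_base p U -> @open (sigma p) U.
Proof.
move=> bU; exists [set U]; first by move=> _ ->.
by rewrite bigcup_set1.
Qed.

(** If the inequality for [y] fails at [z], it fails on the conjugate
    neighborhood of [z] given by [y] alone, with radius the excess
    [p (z - x) y - e]. The conjugate topology is the right one because it bounds
    how far [p _ y] may drop below its value at [z]. *)
Lemma closed_sigma_conj_le (x : X) (e : R) (F : set Y) :
  @closed (sigma_conj p) [set z | forall y, F y -> p (z - x) y <= e].
Proof.
rewrite -[X in closed X]setCK; apply: open_closedC.
exists [set W | sigma_conj_base p W /\
    W `<=` ~` [set z | forall y, F y -> p (z - x) y <= e]]; first by move=> W [].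
apply/seteqP; split => [z [W [_ Wsub] Wz]|z /= /existsNP[y /not_implyP[Fy]]].
  exact: Wsub.
move=> /negP; rewrite -ltNge => ltez.
exists [set z' | forall y', [set y] y' -> p (z - z') y' < p (z - x) y - e];
  last by move=> _ ->; rewrite pairingBl subrr subr_gt0.
split.
  by exists z, (p (z - x) y - e), [set y]; split; rewrite ?subr_gt0.
move=> z' /(_ _ erefl) + /(_ _ Fy).
by rewrite !pairingBl; lra.
Qed.

(** The shrinking hypothesis of [countably_compact_closure_compact] for the identity
    map from [sigma_s p] to [sigma p]. *)
Lemma sigma_regular_in_sigma_s (s : X) (U : set X) :
  @open (sigma p) U -> U s -> exists V C : set X,
  [/\ @open (sigma p) V, V s, @closed (sigma_s p) C, V `<=` C & C `<=` U].
Proof.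
move=> [D' D'b <-] [W D'W /= Ws].
have [x [e [F [e0 Ffin WE]]]] := D'b _ D'W.
have sF : forall y, F y -> p (s - x) y < e by move: Ws; rewrite WE.
(* A basic open set around [s] need not be centered at [s]: [d] is the slack
   left at [s] in the inequalities that define it. *)
have [d d0 dF] : exists2 d : R, 0 < d & forall y, F y -> d <= e - p (s - x) y.
  by apply: finite_slack => // y Fy; rewrite subr_gt0 sF.
exists [set z | forall y, F y -> p (z - s) y < d / 2],
  [set z | forall y, F y -> p (z - s) y <= d / 2]; split.
- by apply: open_sigma_base; exists s, (d / 2), F; split; rewrite // divr_gt0.
- by move=> y _; rewrite pairingBl subrr divr_gt0.
- rewrite -[X in closed X]setCK; apply: open_closedC.
  apply: (@open_sup_topology X bool (sigma_pair p) false).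
  exact/closed_openC/closed_sigma_conj_le.
- by move=> z Vz y Fy; apply/ltW/Vz.
- move=> z Cz; exists W => //; rewrite WE => y Fy; have := Cz _ Fy; have := dF _ Fy.
  by rewrite !pairingBl; lra.
Qed.

End sigma_regularity.

Theorem theorem4p9 (R : realType) (X : lmodType R)
    (Y : lSemiModType {nonneg R}) (p : asym_dual_pair X Y) :
  lindelof (sigma_s p) ->
  forall A : set X, @countable_cover_compact (sigma p) A ->
    @cover_compact (sigma p) (@closure (sigma_s p) A).
Proof.
move=> SL A cA.
have := @countably_compact_closure_compact (sigma_s p) (sigma p) id A.
rewrite !image_id; apply => //.
- apply/continuousP => U; exact: (@open_sup_topology X bool (sigma_pair p) true).
- exact: sigma_regular_in_sigma_s.
Qed.
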